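(* Let $G$ be a group and let $\mathcal{C}\subseteq G\setminus\{e\}$ be a subset which generates $G$, is stable under conjugation by $G$, and is closed under group inversion. Then $\mathcal{C}$, with the operation ${}^ab=aba^{-1}$ and with the inversion map $a\mapsto a^{-1}$ of $G$, is an embeddable IP-quandle. The canonical inclusion $i:\mathcal{C}\hookrightarrow G_{\mathcal{C}}\setminus\{e\}$ is a map of IP-quandles (where $G_{\mathcal C}\setminus\{e\}$ carries conjugation and group inversion), and it is covered by the canonical surjective group homomorphism $\pi:G_{\mathcal{C}}\twoheadrightarrow G$ (sending each generator $a\in\mathcal{C}$ to the element $a\in G$), so that $\pi\circ i=\mathrm{id}$ on $\mathcal C$. Moreover, the kernel $N$ of $\pi$, defined by the exact sequence \[1\to N\to G_{\mathcal{C}}\xrightarrow{\ \pi\ } G\to 1,\] is a central subgroup of $G_{\mathcal{C}}$.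
   Context: A (left) IP-quandle is a set $\mathcal{C}$ with an operation $\mathcal{C}\times\mathcal{C}\to\mathcal{C}$, $(a,b)\mapsto {}^ab$, such that ${}^a({}^bc)={}^{({}^ab)}({}^ac)$ for all $a,b,c$, each map ${}^a(\ )$ is bijective, ${}^aa=a$ for all $a$, together with a permutation $a\mapsto a^{-1}$ of $\mathcal{C}$ such that $(a^{-1})^{-1}=a$, ${}^a(b^{-1})=({}^ab)^{-1}$ and ${}^{a^{-1}}({}^ab)=b$ for all $a,b\in\mathcal{C}$. For an IP-quandle $\mathcal{C}$, the monoid $S_{\mathcal{C}}$ is generated by $\mathcal{C}$ with relations ${}^ab\,a=ab$ for all $a,b\in\mathcal{C}$. The group $G_{\mathcal{C}}$ is $S_{\mathcal{C}}$ modulo the further relations $a^{-1}a=e$ for all $a\in\mathcal{C}$ (here $a^{-1}$ denotes the generator given by the permutation of $\mathcal C$). The IP-quandle $\mathcal{C}$ is embeddable if the canonical inclusion $\mathcal{C}\subset S_{\mathcal{C}}$ descends to an inclusion $\mathcal{C}\subseteq G_{\mathcal{C}}\setminus\{e\}$. A map of IP-quandles is a map commuting with the operations ${}^ab$ and with the inversions. *)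

(* Defs.v *)
From HB Require Import structures.
From mathcomp Require Import all_boot generic_quotient.
From mathcomp Require Import boolp classical_sets.

Set Implicit Arguments.
Unset Strict Implicit.
Unset Printing Implicit Defensive.

Local Open Scope classical_set_scope.
Local Open Scope quotient_scope.
Local Open Scope group_scope.

(* [op a b] is the left action, written ^a b in the literature; it is unrelated
   to the right conjugation [x ^ y] of MathComp, where x ^ y = y^-1 * x * y. *)
Record ip_quandle_axioms (T : Type) (op : T -> T -> T) (inv : T -> T) : Prop :=
  IPQuandleAxioms {
    op_distr : forall a b c, op a (op b c) = op (op a b) (op a c);
    op_bij : forall a, bijective (op a);
    op_idem : forall a, op a a = a;
    inv_bij : bijective inv;
    inv_inv : forall a, inv (inv a) = a;
    op_inv : forall a b, op a (inv b) = inv (op a b);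
    op_invK : forall a b, op (inv a) (op a b) = b
  }.

HB.mixin Record isIPQuandle (T : Type) := {
  qop : T -> T -> T;
  qinv : T -> T;
  qaxioms : ip_quandle_axioms qop qinv
}.

#[short(type="ipQuandleType")]
HB.structure Definition IPQuandle := {T of Choice T & isIPQuandle T}.

Definition IPQuandleOf (T : choiceType) (op : T -> T -> T) (inv : T -> T)
    (ax : ip_quandle_axioms op inv) : ipQuandleType :=
  let m := isIPQuandle.Build T ax in HB.pack T m.

Definition ip_quandle_map (Q1 Q2 : ipQuandleType) (f : Q1 -> Q2) : Prop :=
  (forall a b, f (qop a b) = qop (f a) (f b)) /\
  (forall a, f (qinv a) = qinv (f a)).

Section MonoidQuotient.
Variables (M : monoidType) (r : M -> M -> Prop).

Inductive mcong : M -> M -> Prop :=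
| mcong_gen x y : r x y -> mcong x y
| mcong_refl x : mcong x x
| mcong_sym x y : mcong x y -> mcong y x
| mcong_trans x y z : mcong x y -> mcong y z -> mcong x z
| mcong_mul x x' y y' : mcong x x' -> mcong y y' -> mcong (x * y) (x' * y').

Definition mcongb : rel M := fun x y => `[< mcong x y >].

Lemma mcongb_refl : reflexive mcongb.
Proof. by move=> x; apply/asboolP; exact: mcong_refl. Qed.

Lemma mcongb_sym : symmetric mcongb.
Proof. by move=> x y; apply/asboolP/asboolP; exact: mcong_sym. Qed.

Lemma mcongb_trans : transitive mcongb.
Proof.
by move=> y x z /asboolP xy /asboolP yz; apply/asboolP; exact: mcong_trans yz.
Qed.

Canonical mcongb_equiv := EquivRel mcongb mcongb_refl mcongb_sym mcongb_trans.

Definition mquot := {eq_quot mcongb}.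
HB.instance Definition _ := Choice.on mquot.
HB.instance Definition _ := EqQuotient.on mquot.

Definition mquot_pi (x : M) : mquot := (\pi_mquot x)%qT.

Lemma mquot_piP x y : mquot_pi x = mquot_pi y <-> mcong x y.
Proof.
split=> [/eqP|xy]; first by rewrite eqmodE => /asboolP.
by apply/eqP; rewrite eqmodE; apply/asboolP.
Qed.

Lemma mquot_reprK (u : mquot) : mquot_pi (repr u) = u.
Proof. exact: reprK. Qed.

Lemma mquot_surj (u : mquot) : exists x, u = mquot_pi x.
Proof. by exists (repr u); rewrite mquot_reprK. Qed.

Definition mquot_mul (u v : mquot) : mquot := mquot_pi (repr u * repr v).
Definition mquot_one : mquot := mquot_pi 1.

Lemma mquot_mulE x y : mquot_mul (mquot_pi x) (mquot_pi y) = mquot_pi (x * y).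
Proof. by apply/mquot_piP/mcong_mul; apply/mquot_piP; rewrite mquot_reprK. Qed.

Lemma mquot_mulA : associative mquot_mul.
Proof.
move=> u v w; have [x ->] := mquot_surj u; have [y ->] := mquot_surj v.
by have [z ->] := mquot_surj w; rewrite !mquot_mulE mulgA.
Qed.

Lemma mquot_mul1 : left_id mquot_one mquot_mul.
Proof. by move=> u; have [x ->] := mquot_surj u; rewrite mquot_mulE mul1g. Qed.

Lemma mquot_mul1r : right_id mquot_one mquot_mul.
Proof. by move=> u; have [x ->] := mquot_surj u; rewrite mquot_mulE mulg1. Qed.

HB.instance Definition _ :=
  isMonoid.Build mquot mquot_mulA mquot_mul1 mquot_mul1r.

Lemma mquot_piM x y : mquot_pi (x * y) = mquot_pi x * mquot_pi y.
Proof. exact/esym/mquot_mulE. Qed.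

Lemma mquot_pi1 : mquot_pi 1 = 1.
Proof. by []. Qed.

End MonoidQuotient.

Definition free_monoid (T : Type) := seq T.
HB.instance Definition _ (T : choiceType) := Choice.on (free_monoid T).
HB.instance Definition _ (T : choiceType) :=
  isMonoid.Build (free_monoid T) (@catA T) (@cat0s T) (@cats0 T).

Definition letter (T : choiceType) (a : T) : free_monoid T := [:: a].

Section StructureGroup.
Variable Q : ipQuandleType.

(* ^ab a = a b *)
Definition S_rel (x y : free_monoid Q) : Prop :=
  exists a b : Q, x = letter (qop a b) * letter a /\ y = letter a * letter b.

Definition S_monoid := mquot S_rel.
HB.instance Definition _ := Monoid.on S_monoid.

Definition S_gen (a : Q) : S_monoid := mquot_pi S_rel (letter a).

Definition G_rel (x y : S_monoid) : Prop :=
  exists a : Q, x = S_gen (qinv a) * S_gen a /\ y = 1.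

Definition G_group := mquot G_rel.
HB.instance Definition _ := Monoid.on G_group.

Definition G_gen (a : Q) : G_group := mquot_pi G_rel (S_gen a).

Lemma G_genV a : G_gen (qinv a) * G_gen a = 1.
Proof.
by rewrite -mquot_piM; apply/mquot_piP/mcong_gen; exists a.
Qed.

Lemma G_invertible (u : G_group) : exists v : G_group, v * u = 1 /\ u * v = 1.
Proof.
have [s ->] := mquot_surj u; have [w ->] := mquot_surj s.
elim: w => [|a w [v [vw wv]]]; first by exists 1; rewrite !mul1g.
have -> : a :: w = letter a * w :> free_monoid Q by [].
rewrite !mquot_piM -/(S_gen a) -/(G_gen a).
exists (v * G_gen (qinv a)); split.
  by rewrite mulgA -(mulgA v) G_genV mulg1.
rewrite mulgA -(mulgA (G_gen a)) wv mulg1.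
by rewrite -{1}(inv_inv (qaxioms (s := Q)) a) G_genV.
Qed.

Definition G_inv (u : G_group) : G_group := sval (cid (G_invertible u)).

Lemma G_mulVg : left_inverse 1 G_inv *%g.
Proof. by move=> u; rewrite /G_inv; case: cid => v []. Qed.

Lemma G_mulgV : right_inverse 1 G_inv *%g.
Proof. by move=> u; rewrite /G_inv; case: cid => v []. Qed.

HB.instance Definition _ := hasInv.Build G_group G_inv.
HB.instance Definition _ := Monoid_isGroup.Build G_group G_mulVg G_mulgV.

(* [G_gen] is the composite of [S_gen] with the projection to [G_group]; its
   injectivity forces that of [S_gen]. *)
Definition embeddable : Prop := injective G_gen /\ forall a, G_gen a != 1.

End StructureGroup.

Section Nonidentity.
Variable G : groupType.

Definition nonid := {x : G | x != 1}.
HB.instance Definition _ := Choice.on nonid.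
HB.instance Definition _ := SubType.on nonid.

Lemma nonid_conj_subproof (a b : nonid) : val a * val b * (val a)^-1 != 1.
Proof.
apply: contra (valP b) => /eqP ab1; apply/eqP.
by rewrite -[val b](mulKg (val a)) -(mulgVK (val a) (val a * val b)) ab1
  mul1g mulVg.
Qed.

Lemma nonid_inv_subproof (a : nonid) : (val a)^-1 != 1.
Proof. by apply: contra (valP a) => /eqP a1; rewrite -[val a]invgK a1 invg1. Qed.

Definition nonid_conj (a b : nonid) : nonid :=
  exist (fun x : G => x != 1) _ (nonid_conj_subproof a b).
Definition nonid_inv (a : nonid) : nonid :=
  exist (fun x : G => x != 1) _ (nonid_inv_subproof a).

Lemma nonid_axioms : ip_quandle_axioms nonid_conj nonid_inv.
Proof.
have invK : involutive nonid_inv by move=> a; apply: val_inj; rewrite /= invgK.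
have conjVK a : cancel (nonid_conj a) (nonid_conj (nonid_inv a)).
  by move=> b; apply: val_inj; rewrite /= invgK !mulgA mulVg mul1g mulgVK.
split=> //.
- by move=> a b c; apply: val_inj; rewrite /= !invgM !invgK !mulgA !mulgVK.
- move=> a; exists (nonid_conj (nonid_inv a)) => // b.
  by rewrite -{1}(invK a) conjVK.
- by move=> a; apply: val_inj; rewrite /= mulgK.
- by exists nonid_inv.
- by move=> a b; apply: val_inj; rewrite /= !invgM !invgK !mulgA.
Qed.

HB.instance Definition _ := isIPQuandle.Build nonid nonid_axioms.

End Nonidentity.

Definition embedding (Q : ipQuandleType) (E : embeddable Q) (a : Q) :
  nonid (G_group Q) := exist (fun x => x != 1) (G_gen a) (proj2 E a).

Section ConjugationSubset.
Variables (G : groupType) (C : set G).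

Definition conj_stable := forall g a, C a -> C (g * a * g^-1).
Definition inv_stable := forall a, C a -> C a^-1.

Definition conj_op (hJ : conj_stable) (a b : C) : C :=
  SigSub (mem_set (hJ (val a) (val b) (set_mem (valP b)))).

Definition inv_op (hV : inv_stable) (a : C) : C :=
  SigSub (mem_set (hV (val a) (set_mem (valP a)))).

End ConjugationSubset.

Section Subgroups.
Variable G : groupType.

Definition subgroup (H : set G) : Prop :=
  [/\ H 1, forall x y, H x -> H y -> H (x * y) & forall x, H x -> H x^-1].

Definition generates (A : set G) : Prop := smallest subgroup A = [set: G].

Definition center : set G := [set z | forall x, commute z x].

Definition central_subgroup (H : set G) : Prop := subgroup H /\ H `<=` center.

End Subgroups.

Definition kernel (G H : groupType) (f : {multiplicative G -> H}) : set G :=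
  f @^-1` [set 1].

(* Main.v *)
Require Import Defs.
From HB Require Import structures.
From mathcomp Require Import all_boot.
From mathcomp Require Import boolp classical_sets.

Set Implicit Arguments.
Unset Strict Implicit.
Unset Printing Implicit Defensive.

Local Open Scope classical_set_scope.
Local Open Scope group_scope.

(** The relations of [G_group Q] say exactly that the letters of [Q] conjugate
    one another by the quandle operation and that [qinv] is inversion.  Hence
    a map [f] from [Q] to a group that turns the quandle structure into
    conjugation and inversion extends to a homomorphism [G_lift] on
    [G_group Q].  For the quandle [Q] carried by [C] this applies to the
    inclusion [f] of [C] in [G]; the extension is [pi].  Because [pi] sends
    [G_gen a] to [a], distinct elements of [C] give distinct, nontrivial
    generators of [G_group Q], which is embeddability.  The image of [pi] is a
    subgroup containing [C], so it is all of [G].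

    Centrality of the kernel comes from the fact that [G_group Q] permutes the
    generators by conjugation ([G_gen_conj_stable]).  If [pi u = 1] and [u]
    conjugates the generator [b] to the generator [c], then applying [pi] gives
    [f b = f c], so [b = c] as soon as [f] is injective: [u] commutes with every
    generator, hence with everything ([kernel_G_lift_central]). *)

(** * Maps out of the structure group *)

Lemma mcong_compat (M H : monoidType) (r : M -> M -> Prop) (f : M -> H) :
  {morph f : x y / x * y} -> (forall x y, r x y -> f x = f y) ->
  forall x y, mcong r x y -> f x = f y.
Proof.
move=> fM fr x y; elim=> {x y} //.
- by move=> x y z _ -> _ ->.
- by move=> x x' y y' _ fx _ fy; rewrite !fM fx fy.
Qed.

Definition mquot_lift (M H : monoidType) (r : M -> M -> Prop) (f : M -> H)
  (u : mquot r) : H := f (repr u).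

Section MquotLift.
Context (M H : monoidType) (r : M -> M -> Prop) (f : M -> H).
Context (fM : {morph f : x y / x * y}).
Context (fr : forall x y, r x y -> f x = f y).

Lemma mquot_lift_pi x : mquot_lift f (mquot_pi r x) = f x.
Proof. by apply: (mcong_compat fM fr); apply/mquot_piP; rewrite mquot_reprK. Qed.

Lemma mquot_liftM : {morph @mquot_lift _ _ r f : u v / u * v}.
Proof.
move=> u v; have [x ->] := mquot_surj u; have [y ->] := mquot_surj v.
by rewrite -mquot_piM !mquot_lift_pi fM.
Qed.

End MquotLift.

(** These are the maps of IP-quandles to a group, with conjugation; they may take
    the value [1], so their target is not the quandle [nonid H]. *)
Definition conj_rep (Q : ipQuandleType) (H : groupType) (f : Q -> H) : Prop :=
  (forall a b, f (qop a b) = f a * f b * (f a)^-1) /\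
  (forall a, f (qinv a) = (f a)^-1).

Definition word_eval (Q : ipQuandleType) (H : groupType) (f : Q -> H)
  (w : free_monoid Q) : H := \prod_(a <- w) f a.

(** The proof [fP] is carried as an argument so that the homomorphism structure
    can be attached to [G_lift fP]. *)
Definition G_lift (Q : ipQuandleType) (H : groupType) (f : Q -> H)
    (fP : conj_rep f) : G_group Q -> H :=
  mquot_lift (mquot_lift (word_eval f)).

Section GLift.
Context (Q : ipQuandleType) (H : groupType) (f : Q -> H) (fP : conj_rep f).

Let word_evalM : {morph word_eval f : x y / x * y}.
Proof. by move=> x y; rewrite /word_eval big_cat. Qed.

Let word_eval_letter a : word_eval f (letter a) = f a.
Proof. by rewrite /word_eval big_seq1. Qed.

Let word_eval_S_rel x y : S_rel x y -> word_eval f x = word_eval f y.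
Proof.
move=> [a [b [-> ->]]].
by rewrite !word_evalM !word_eval_letter (proj1 fP) mulgVK.
Qed.

Let S_liftM := mquot_liftM word_evalM word_eval_S_rel.
Let S_lift_pi := mquot_lift_pi word_evalM word_eval_S_rel.

Let S_lift_G_rel x y :
  G_rel x y -> mquot_lift (word_eval f) x = mquot_lift (word_eval f) y.
Proof.
move=> [a [-> ->]]; rewrite S_liftM !S_lift_pi !word_eval_letter (proj2 fP).
by rewrite mulVg /word_eval big_nil.
Qed.

Lemma G_lift_gen a : G_lift fP (G_gen a) = f a.
Proof.
by rewrite [LHS](mquot_lift_pi S_liftM S_lift_G_rel) S_lift_pi word_eval_letter.
Qed.

Lemma G_liftM : {morph G_lift fP : u v / u * v}.
Proof. exact: mquot_liftM S_liftM S_lift_G_rel. Qed.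

Lemma G_liftF : {morph G_lift fP : u v / u / v}.
Proof. by move=> u v; apply: (mulIg (G_lift fP v)); rewrite -G_liftM !mulgVK. Qed.

End GLift.

HB.instance Definition _ Q H f fP :=
  isGroupMorphism.Build _ _ (@G_lift Q H f fP) (G_liftF fP).

(** * Conjugation in the structure group *)

(** No letter for an inverse generator occurs in the induction because the
    inverse of a generator is again a generator. *)
Lemma G_group_ind (Q : ipQuandleType) (P : G_group Q -> Prop) :
  P 1 -> (forall a u, P u -> P (G_gen a * u)) -> forall u, P u.
Proof.
move=> P1 PM u; have [s ->] := mquot_surj u; have [w ->] := mquot_surj s.
elim: w => [|a w IHw]; first exact: P1.
have -> : a :: w = letter a * w :> free_monoid Q by [].
by rewrite !mquot_piM; apply: PM.
Qed.

Lemma G_gen_conj_rep (Q : ipQuandleType) : conj_rep (@G_gen Q).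
Proof.
split=> [a b|a]; last by apply: (mulIg (G_gen a)); rewrite G_genV mulVg.
apply: (mulIg (G_gen a)); rewrite mulgVK -!mquot_piM; congr mquot_pi.
by apply/mquot_piP/mcong_gen; exists a, b.
Qed.

(** Since every element is a product of generators, it is enough that a generator
    conjugates generators to generators, which is the defining relation. *)
Lemma G_gen_conj_stable (Q : ipQuandleType) (u : G_group Q) (b : Q) :
  exists c, u * G_gen b * u^-1 = G_gen c.
Proof.
elim/G_group_ind: u b => [|a u IHu] b.
  by exists b; rewrite invg1 mulg1 mul1g.
have [c uc] := IHu b; exists (qop a c).
by rewrite (proj1 (G_gen_conj_rep Q)) -uc invgM !mulgA.
Qed.

Lemma G_group_center (Q : ipQuandleType) (u : G_group Q) :
  (forall b, commute u (G_gen b)) -> center u.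
Proof.
move=> ub; elim/G_group_ind => [|b v uv]; first exact: commute1.
exact: commuteM.
Qed.

(** * The kernel of the extension *)

Lemma subgroup_kernel (G H : groupType) (f : UMagmaMorphism.type G H) :
  subgroup (kernel f).
Proof.
rewrite /kernel; split=> [|x y /= fx fy|x /= fx] /=; first exact: gmulf1.
  by rewrite gmulfM fx fy mulg1.
by rewrite gmulfV fx invg1.
Qed.

(** Injectivity of [f] recovers a generator from its image in [H], so an element
    of the kernel, which acts trivially on the images, acts trivially on the
    generators. *)
Lemma kernel_G_lift_central (Q : ipQuandleType) (H : groupType) (f : Q -> H)
    (fP : conj_rep f) :
  injective f -> central_subgroup (kernel (G_lift fP)).
Proof.
move=> f_inj; split; first exact: subgroup_kernel.
rewrite /kernel => u /= fu; apply: G_group_center => b.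
have [c uc] := G_gen_conj_stable u b.
have cb : c = b.
  apply: f_inj; rewrite -!(G_lift_gen fP) -uc !gmulfM gmulfV.
  by rewrite /= fu invg1 mulg1 mul1g.
by rewrite /commute -[RHS]mul1g; apply: (mulIg u^-1); rewrite uc cb mul1g mulgK.
Qed.

Lemma subgroup_range (G H : groupType) (f : UMagmaMorphism.type G H) :
  subgroup (range f).
Proof.
split=> [|_ _ [x _ <-] [y _ <-]|_ [x _ <-]]; first by exists 1; rewrite ?gmulf1.
  by exists (x * y); rewrite ?gmulfM.
by exists x^-1; rewrite ?gmulfV.
Qed.

Lemma generates_surj (G H : groupType) (f : UMagmaMorphism.type G H)
    (A : set H) :
  generates A -> A `<=` range f -> forall h, exists x, f x = h.
Proof.
move=> A_gen Af h.
have : smallest (@subgroup H) A h by rewrite A_gen.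
by move=> /(_ (range f)) [|x _ <-]; [split=> //; exact: subgroup_range|exists x].
Qed.

(** * Conjugation-stable subsets *)

Section ConjSubset.
Context (G : groupType) (C : set G).
Context (C_conj : conj_stable C) (C_inv : inv_stable C).

Lemma conj_subset_axioms :
  ip_quandle_axioms (conj_op C_conj) (inv_op C_inv).
Proof.
have invK : involutive (inv_op C_inv).
  by move=> a; apply: val_inj; rewrite /= invgK.
have conjVK a : cancel (conj_op C_conj a) (conj_op C_conj (inv_op C_inv a)).
  by move=> b; apply: val_inj; rewrite /= invgK !mulgA mulVg mul1g mulgVK.
split=> //.
- by move=> a b c; apply: val_inj; rewrite /= !invgM !invgK !mulgA !mulgVK.
- move=> a; exists (conj_op C_conj (inv_op C_inv a)) => // b.
  by rewrite -{1}(invK a) conjVK.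
- by move=> a; apply: val_inj; rewrite /= mulgK.
- by exists (inv_op C_inv).
- by move=> a b; apply: val_inj; rewrite /= !invgM !invgK !mulgA.
Qed.

Lemma val_conj_rep :
  @conj_rep (IPQuandleOf conj_subset_axioms) G (fun a : C => val a).
Proof. by []. Qed.

End ConjSubset.

(** The evaluation on [G_gen] of an extension of [f] returns [f], so whatever
    [f] separates is separated in the structure group. *)
Lemma embeddable_conj_rep (Q : ipQuandleType) (H : groupType) (f : Q -> H) :
  conj_rep f -> injective f -> (forall a, f a != 1) -> embeddable Q.
Proof.
move=> fP f_inj f1; split=> [a b ab|a].
  by apply: f_inj; rewrite -!(G_lift_gen fP) ab.
by apply: contra (f1 a) => /eqP a1; rewrite -(G_lift_gen fP) a1 gmulf1.
Qed.

Lemma embedding_ip_quandle_map (Q : ipQuandleType) (E : embeddable Q) :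
  ip_quandle_map (embedding E).
Proof.
have [genJ genV] := G_gen_conj_rep Q.
by split=> [a b|a]; apply: val_inj; rewrite /= ?genJ ?genV.
Qed.

Theorem proposition2p4 (G : groupType) (C : set G)
    (C_nonid : C `<=` ~` [set 1])
    (C_gen : generates C)
    (C_conj : conj_stable C)
    (C_inv : inv_stable C) :
  exists ax : ip_quandle_axioms (conj_op C_conj) (inv_op C_inv),
  let Q : ipQuandleType := IPQuandleOf ax in
  exists E : embeddable Q,
    ip_quandle_map (embedding E) /\
    exists pi : {multiplicative G_group Q -> G},
      [/\ forall a : C, pi (G_gen (a : Q)) = val a,
          forall a : C, pi (val (embedding E (a : Q))) = val a,
          forall g : G, exists x, pi x = g
        & central_subgroup (kernel pi)].
Proof.
exists (conj_subset_axioms C_conj C_inv) => Q.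
have repC : @conj_rep Q G (fun a : C => val a) := val_conj_rep C_conj C_inv.
have val1 (a : C) : val a != 1.
  by apply/eqP; apply: C_nonid; apply: set_mem; apply: valP.
exists (embeddable_conj_rep repC val_inj val1).
split; first exact: embedding_ip_quandle_map.
exists (G_lift repC : {multiplicative _ -> _}); split.
- exact: (G_lift_gen repC).
- exact: (G_lift_gen repC).
- apply: (generates_surj C_gen) => g Cg.
  by exists (G_gen (SigSub (mem_set Cg) : Q)); rewrite // /= (G_lift_gen repC).
- exact: (kernel_G_lift_central repC val_inj).
Qed.
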